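(* Let $\alpha,\beta$ be prenamings with $C^+(\alpha)\cap C^+(\beta)=\emptyset$ and $R^+(\alpha)\cap R^+(\beta)=\emptyset$, so that $\alpha\oplus\beta$ is defined, and let $t$ be a term. (1) If $\alpha$ is safe for $t$ and $\beta$ is safe for $t$, then $\alpha\oplus\beta$ is safe for $t$. (2) If $\alpha$ is complete for $t$, then $\alpha\oplus\beta$ is complete (hence safe) for $t$, and $(\alpha\oplus\beta)(t)=\alpha(t)$.
   Context: $V$ is a countably infinite set of variables, $\mathrm{vars}(t)$ the set of variables of a term $t$. A substitution maps variables to terms with finite active domain $\mathrm{Dom}(\theta)=\{x:\theta(x)\neq x\}$, extended homomorphically to terms. A prenaming is a substitution $\alpha$ mapping variables to variables together with a fixed finite set $C^+(\alpha)\supseteq\mathrm{Dom}(\alpha)$ (relaxed core) on which $\alpha$ is injective; $R^+(\alpha)=\alpha(C^+(\alpha))$. The sum $\alpha\oplus\beta$ is the prenaming with relaxed core $C^+(\alpha)\cup C^+(\beta)$ agreeing with $\alpha$ on $C^+(\alpha)$, with $\beta$ on $C^+(\beta)$, identity elsewhere. $\mathrm{noninj}(\alpha)=R^+(\alpha)\setminus C^+(\alpha)$, $\mathrm{indom}(\alpha)=V\setminus\mathrm{noninj}(\alpha)$. $\alpha$ is safe for $t$ if $\mathrm{vars}(t)\subseteq\mathrm{indom}(\alpha)$, and complete for $t$ if $\mathrm{vars}(t)\subseteq C^+(\alpha)$. *)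

(* Defs.v *)
(* MathComp, with finmap for finite sets of variables. *)
From HB Require Import structures.
From mathcomp Require Import all_boot finmap.

Set Implicit Arguments.
Unset Strict Implicit.
Unset Printing Implicit Defensive.

Local Open Scope fset_scope.

Section Terms.
Variables (V : choiceType) (F : Type) (ar : F -> nat).

(* First-order terms over variables V and a signature of functors F with
   arities ar; finite functions make equality of argument lists extensional. *)
Inductive term : Type :=
| Var of V
| App (f : F) of {ffun 'I_(ar f) -> term}.

Fixpoint vars (t : term) : {fset V} :=
  match t with
  | Var x => [fset x]
  | App f args => \big[fsetU/fset0]_(i < ar f) vars (args i)
  end.

Definition Dom (theta : V -> term) (x : V) : Prop := theta x <> Var x.

Record subst : Type := Subst {
  subst_fun :> V -> term;
  _ : exists A : {fset V}, forall x, Dom subst_fun x -> x \in A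
}.

Fixpoint apply (theta : subst) (t : term) : term :=
  match t with
  | Var x => theta x
  | App f args => App [ffun i => apply theta (args i)]
  end.

(* A variable-to-variable substitution is given by its underlying map on V,
   the substitution itself being [pren_subst] below. *)
Record prenaming : Type := Prenaming {
  pren_fun : V -> V;
  Cplus : {fset V};
  Dom_Cplus : forall x, Dom (fun y => Var (pren_fun y)) x -> x \in Cplus;
  Cplus_inj : {in Cplus &, injective pren_fun}
}.

Definition pren_subst (alpha : prenaming) : subst :=
  @Subst (fun x => Var (pren_fun alpha x))
         (ex_intro _ (Cplus alpha) (@Dom_Cplus alpha)).

Definition Rplus (alpha : prenaming) : {fset V} :=
  [fset pren_fun alpha x | x in Cplus alpha].

Definition noninj (alpha : prenaming) : {fset V} := Rplus alpha `\` Cplus alpha.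

Definition indom (alpha : prenaming) : {pred V} :=
  [pred x | x \notin noninj alpha].

Definition safe (alpha : prenaming) (t : term) : Prop :=
  {subset vars t <= indom alpha}.

Definition complete (alpha : prenaming) (t : term) : Prop :=
  {subset vars t <= Cplus alpha}.

Section Sum.
Variables (alpha beta : prenaming).
Hypothesis disjC : Cplus alpha `&` Cplus beta = fset0.
Hypothesis disjR : Rplus alpha `&` Rplus beta = fset0.

Definition psum_fun (x : V) : V :=
  if x \in Cplus alpha then pren_fun alpha x
  else if x \in Cplus beta then pren_fun beta x
  else x.

Lemma psum_Dom_Cplus (x : V) :
  Dom (fun y => Var (psum_fun y)) x -> x \in Cplus alpha `|` Cplus beta.
Proof.
rewrite /Dom /psum_fun in_fsetU.
by case: (x \in Cplus alpha) => //; case: (x \in Cplus beta).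
Qed.

Lemma Rplus_neq (x y : V) : x \in Cplus alpha -> y \in Cplus beta ->
  pren_fun alpha x <> pren_fun beta y.
Proof.
move=> xa yb e.
have: pren_fun alpha x \in Rplus alpha `&` Rplus beta.
  by rewrite in_fsetI {2}e !in_imfset.
by rewrite disjR in_fset0.
Qed.

Lemma psum_Cplus_inj : {in Cplus alpha `|` Cplus beta &, injective psum_fun}.
Proof.
move=> x y; rewrite !in_fsetU /psum_fun.
case: (boolP (x \in Cplus alpha)) => /= [xa _|_ xb];
  case: (boolP (y \in Cplus alpha)) => /= [ya _|_ yb].
- exact: Cplus_inj.
- by rewrite yb => /(Rplus_neq xa yb).
- by rewrite xb => /esym /(Rplus_neq ya xb).
- by rewrite xb yb; apply: Cplus_inj.
Qed.

(* Injectivity on the relaxed core only needs [disjR]; [disjC] is what makes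
   the sum agree with beta on the relaxed core of beta ([psum_beta]). *)
Definition psum : prenaming := Prenaming psum_Dom_Cplus psum_Cplus_inj.

Lemma psum_alpha (x : V) :
  x \in Cplus alpha -> pren_fun psum x = pren_fun alpha x.
Proof. by rewrite /= /psum_fun => ->. Qed.

Lemma psum_beta (x : V) :
  x \in Cplus beta -> pren_fun psum x = pren_fun beta x.
Proof.
move=> xb; rewrite /= /psum_fun; case: ifP => [xa|_]; last by rewrite xb.
have: x \in Cplus alpha `&` Cplus beta by rewrite in_fsetI xa xb.
by rewrite disjC in_fset0.
Qed.

Lemma psum_id (x : V) :
  x \notin Cplus alpha `|` Cplus beta -> pren_fun psum x = x.
Proof.
by rewrite /= /psum_fun in_fsetU; case: (x \in Cplus alpha); case: (x \in Cplus beta).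
Qed.

End Sum.
End Terms.

(* Main.v *)
Require Import Defs.
From mathcomp Require Import all_boot finmap.
From mathcomp Require Import classical_sets cardinality.

(** A variable in [noninj] of the sum lies outside both cores and, by [Rplus_psum_subset], in the
    range of [alpha] or of [beta]; it is then in [noninj] of that prenaming, so safety for both
    excludes it from [t]. For completeness, the core of the sum contains that of [alpha], where the
    two maps agree, and by [eq_in_apply] an instance of [t] depends only on the values at the
    variables of [t]. *)

Section TermInduction.
Variables (V : choiceType) (F : Type) (ar : F -> nat).

(* The induction principle generated for [term] has no hypothesis on the
   arguments of a functor, as they are nested inside a finite function. *)
Lemma term_nested_ind (P : term V ar -> Prop) :
  (forall x, P (Var ar x)) ->
  (forall f (args : {ffun 'I_(ar f) -> term V ar}),
     (forall i, P (args i)) -> P (App args)) ->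
  forall t, P t.
Proof.
move=> PVar PApp; fix IH 1 => -[x|f args]; first exact: PVar.
by apply: PApp => i; apply: IH.
Qed.

Lemma vars_App_subset (f : F) (args : {ffun 'I_(ar f) -> term V ar}) i :
  {subset vars (args i) <= vars (App args)}.
Proof.
by move=> x xi; apply/bigfcupP; exists i; rewrite ?mem_index_enum.
Qed.

Lemma eq_in_apply (theta sigma : subst V ar) (t : term V ar) :
  {in vars t, theta =1 sigma} -> apply theta t = apply sigma t.
Proof.
elim/term_nested_ind: t => [x|f args IH] eq_ts /=.
  by apply: eq_ts; rewrite inE.
congr App; apply/ffunP => i; rewrite !ffunE; apply: IH => x xi.
exact/eq_ts/vars_App_subset/xi.
Qed.

End TermInduction.

Section PrenamingSum.
Variables (V : choiceType) (F : Type) (ar : F -> nat).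
Variables (alpha beta : prenaming V ar).
Hypothesis disjR : (Rplus alpha `&` Rplus beta)%fset = fset0.

(** Since [noninj] is the range minus the core, every core variable lies in [indom]. *)
Lemma complete_safe (t : term V ar) : complete alpha t -> safe alpha t.
Proof. by move=> ct x /ct xC; rewrite !inE xC. Qed.

(** On its core the sum acts as [alpha] or as [beta], at a point of that prenaming's own core. *)
Lemma Rplus_psum_subset :
  {subset Rplus (psum disjR) <= (Rplus alpha `|` Rplus beta)%fset}.
Proof.
move=> y /imfsetP[x /=]; rewrite in_fsetU /psum_fun => xC ->{y}.
rewrite in_fsetU; case: ifP xC => [xa _|_ /= xb].
  by rewrite in_imfset.
by rewrite xb [X in _ || X]in_imfset ?orbT.
Qed.

Lemma safe_psum (t : term V ar) :
  safe alpha t -> safe beta t -> safe (psum disjR) t.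
Proof.
move=> sa sb x xt; move: (sa x xt) (sb x xt).
rewrite !inE !negb_and !negbK => xa xb.
(* A variable in either core is in the core of the sum, hence in its [indom]. Outside both cores,
   safety says that [x] is in neither range. *)
case: (boolP (x \in Cplus alpha)) xa => //= _ xRa.
case: (boolP (x \in Cplus beta)) xb => //= _ xRb.
apply/negP => /Rplus_psum_subset; rewrite in_fsetU.
by rewrite (negbTE xRa) (negbTE xRb).
Qed.

Lemma complete_psum (t : term V ar) :
  complete alpha t -> complete (psum disjR) t.
Proof. by move=> ct x /ct xC; rewrite in_fsetU xC. Qed.

Lemma apply_psum (t : term V ar) : complete alpha t ->
  apply (pren_subst (psum disjR)) t = apply (pren_subst alpha) t.
Proof.
by move=> ct; apply: eq_in_apply => x /ct xC; congr Var; apply: psum_alpha.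
Qed.

End PrenamingSum.

Theorem mainTheorem4 (V : choiceType)
  (V_countably_infinite : ([set: V]%classic #= [set: nat]%classic)%card)
  (F : Type) (ar : F -> nat) (alpha beta : prenaming V ar)
  (disjC : (Cplus alpha `&` Cplus beta)%fset = fset0)
  (disjR : (Rplus alpha `&` Rplus beta)%fset = fset0)
  (t : term V ar) :
  (safe alpha t -> safe beta t -> safe (psum disjR) t) /\
  (complete alpha t ->
     [/\ complete (psum disjR) t,
         safe (psum disjR) t &
         apply (pren_subst (psum disjR)) t = apply (pren_subst alpha) t]).
Proof.
split=> [|ct]; first exact: safe_psum.
have cst := complete_psum _ _ _ _ _ disjR _ ct.
by split=> //; [apply: complete_safe | apply: apply_psum].
Qed.
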